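(* Let $F$ be an algebraically closed field or $F = \mathbb{R}$, and let $m, n, r$ be nonnegative integers with $r < \min\{m, n\}$. Let $X \in F_{\le r}^{m \times n}$ and let $\underline{r} := \operatorname{rank} X$. Let $P \in F^{m \times (m-\underline{r})}$ have rank $m-\underline{r}$ and $Q \in F^{n \times (n-\underline{r})}$ have rank $n-\underline{r}$, with $\operatorname{im} P = \ker X^\top$ and $\operatorname{im} Q = \ker X$. Then: \begin{enumerate} \item the algebraic tangent cone to $F_{\le r}^{m \times n}$ at $X$ is \[ \left\{Z \in F^{m \times n} \mid \operatorname{rank} (P^\top Z Q) \le r-\underline{r}\right\}; \] \item if $F = \mathbb{R}$, then the tangent cone $T_{\mathbb{R}_{\le r}^{m \times n}}(X)$ equals the algebraic tangent cone to $\mathbb{R}_{\le r}^{m \times n}$ at $X$. \end{enumerate}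
   Context: For a field $F$, $F_{\le r}^{m \times n} := \{Y \in F^{m \times n} \mid \operatorname{rank} Y \le r\}$; it is an affine algebraic subset of $F^{m \times n}$ (the common zero set of all minors of order $r+1$). For a matrix $Y \in F^{m\times n}$, $\operatorname{im} Y := Y F^n$. Algebraic tangent cone. Let $F$ be a field. An affine algebraic subset of $F^N$ is the set of common roots in $F^N$ of a set of polynomials in $F[X_1, \dots, X_N]$. For $f \in F[X_1, \dots, X_N]$ and $x \in F^N$, write $f = \sum_{i=0}^d f_{x,i}$ where each $f_{x,i}$ is a linear combination over $F$ of products $\prod_{j=1}^N (X_j - x_j)^{k_j}$ with $k_j \in \mathbb{N}$ and $\sum_{j=1}^N k_j = i$. If $f \ne 0$, the initial polynomial of $f$ at $x$ is $f_{x,i}$ for the smallest $i$ with $f_{x,i} \ne 0$. For an affine algebraic subset $A$ of $F^N$ and $x \in A$, the algebraic tangent cone to $A$ at $x$ is the set of common roots of the initial polynomials at $x$ of all (nonzero) polynomials in $F[X_1,\dots,X_N]$ that vanish on $A$. Here $F^{m \times n}$ is identified with $F^{mn}$. Tangent cone. For $S \subseteq \mathbb{R}^{m \times n}$ and $x \in S$, $T_S(x)$ is the set of all $v \in \mathbb{R}^{m \times n}$ for which there exist sequences $(x_i)_{i \in \mathbb{N}}$ in $S$ converging to $x$ and $(t_i)_{i \in \mathbb{N}}$ in $(0, \infty)$ such that $\left(\frac{x_i - x}{t_i}\right)_{i \in \mathbb{N}}$ converges to $v$. *)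

(* Defs.v *)
From HB Require Import structures.
From mathcomp Require Import all_boot all_order all_algebra.
From mathcomp Require mpoly.

Set Implicit Arguments.
Unset Strict Implicit.
Unset Printing Implicit Defensive.

Import Order.TTheory GRing.Theory Num.Theory.

Local Open Scope ring_scope.

(* The notations of mpoly and of mathcomp-analysis cannot be imported together:
   those of mpoly are imported in this section only. *)
Section InitialPolynomial.
Import mpoly.
Variables (F : fieldType) (N : nat).
Implicit Types (x : 'rV[F]_N) (f p : {mpoly F[N]}).

Definition homogeneous_at x (i : nat) p : Prop :=
  exists c : 'X_{1..N} -> F,
    p = \sum_(k : 'X_{1..N < i.+1} | mdeg k == i)
          c k *: \prod_(j < N) ('X_j - (x 0 j)%:MP) ^+ (k : 'X_{1..N}) j.

Definition expansion_at x f (d : nat) (g : nat -> {mpoly F[N]}) : Prop :=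
  (forall i, (i <= d)%N -> homogeneous_at x i (g i)) /\
  f = \sum_(0 <= i < d.+1) g i.

Definition initial_polynomial x f p : Prop :=
  exists (d : nat) (g : nat -> {mpoly F[N]}) (i : nat),
    [/\ expansion_at x f d g, (i <= d)%N, g i != 0,
        forall j, (j < i)%N -> g j = 0 & p = g i].

End InitialPolynomial.

From mathcomp Require Import boolp classical_sets.
From mathcomp Require Import reals topology normedtype.
Import -(notations) mpoly.
Import numFieldNormedType.Exports.
Local Open Scope classical_set_scope.

Section AlgebraicTangentCone.
Variables (F : fieldType) (N : nat).

Definition vanishes_on (f : mpoly N F) (A : set 'rV[F]_N) : Prop :=
  forall a, A a -> meval (a 0) f = 0.

(* The initial polynomials at [x] are polynomials in the differences X_j - x_j,
   and their common roots [v] are not translated back by [x]: the cone has its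
   apex at [x]. *)
Definition algebraic_tangent_cone (A : set 'rV[F]_N) (x : 'rV[F]_N) :
    set 'rV[F]_N :=
  [set v | forall f p : mpoly N F,
    f != 0 -> vanishes_on f A -> initial_polynomial x f p ->
    meval (v 0) p = 0].

End AlgebraicTangentCone.

Section Matrices.
Variables (F : fieldType) (m n : nat).

(* F^(m x n) is identified with F^(m * n) through [mxvec]. *)
Definition mx_algebraic_tangent_cone (A : set 'M[F]_(m, n)) (X : 'M[F]_(m, n)) :
    set 'M[F]_(m, n) :=
  [set Z | algebraic_tangent_cone (mxvec @` A) (mxvec X) (mxvec Z)].

Definition rank_le (r : nat) : set 'M[F]_(m, n) :=
  [set Y | (\rank Y <= r)%N].

(* Images and kernels are those of the action on column vectors, whereas
   [kermx] and the [%MS] scope of mxalgebra are about row spaces. *)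
Definition mxim (Y : 'M[F]_(m, n)) : set 'cV[F]_m :=
  [set Y *m v | v in [set: 'cV[F]_n]].

Definition mxker (Y : 'M[F]_(m, n)) : set 'cV[F]_n :=
  [set v | Y *m v = 0].

End Matrices.

Arguments rank_le F m n r : clear implicits.

Definition tangent_cone (R : realType) (m n : nat) (S : set 'M[R]_(m, n))
    (x : 'M[R]_(m, n)) : set 'M[R]_(m, n) :=
  [set v | exists (x_ : nat -> 'M[R]_(m, n)) (t_ : nat -> R),
    [/\ forall i, S (x_ i),
        x_ i @[i --> \oo] --> x,
        forall i, 0 < t_ i &
        (t_ i)^-1 *: (x_ i - x) @[i --> \oo] --> v]].

(* Main.v *)
(** For [X] of rank [s], border an invertible [s] x [s] minor of [X] by
    [k = r - s + 1] vectors of the left and of the right kernel of [X]. The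
    resulting minor of order [r + 1] vanishes on the matrices of rank at most
    [r], and since the bordering vectors kill [X], its value at [X + t Z] is
    [t^k] times a determinant whose value at [t = 0] is a minor of order [k] of
    [P^T Z Q]. Hence this minor is an initial polynomial at [X], and it also
    vanishes at the limits of difference quotients. Conversely, when
    [P^T Z Q] has rank at most [r - s], there is a polynomial curve
    [X + t Z + O(t^2)] of matrices of rank at most [r]: it realizes [Z] as a
    tangent vector, and it annihilates all initial polynomials at [X]. *)

Require Import Defs.
From mathcomp Require Import all_boot all_order all_algebra.
From mathcomp Require mpoly.

Set Implicit Arguments.
Unset Strict Implicit.
Unset Printing Implicit Defensive.

Import GRing.Theory.
Local Open Scope ring_scope.

(** * Homogeneous components and initial polynomials at a point *)

Section PolynomialExpansions.
Import mpoly.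
Variables (F : fieldType) (N : nat).
Implicit Types (x : 'rV[F]_N) (f p : {mpoly F[N]}) (S : comNzRingType).

Lemma rmorph_mmap (S T : comNzRingType) (phi : {rmorphism S -> T})
    (c : F -> S) (h : 'I_N -> S) p :
  phi (mmap c h p) = mmap (phi \o c) (phi \o h) p.
Proof.
rewrite /mmap rmorph_sum; apply: eq_bigr => k _.
rewrite rmorphM /mmap1 rmorph_prod; congr (_ * _).
by apply: eq_bigr => j _; rewrite rmorphXn.
Qed.

Lemma eq_mmap S (c1 c2 : F -> S) (h1 h2 : 'I_N -> S) p :
  c1 =1 c2 -> h1 =1 h2 -> mmap c1 h1 p = mmap c2 h2 p.
Proof.
by move=> eqc eqh; apply: eq_bigr => k _; rewrite eqc (mmap1_eq _ eqh).
Qed.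

(** Each difference X_j - x_j is sent to [t * y j], and the exponents of every product add up to
    [i]. *)
Lemma homogeneous_mmap S (c : {rmorphism F -> S}) x (y : 'I_N -> S) t i p :
  homogeneous_at x i p ->
  mmap c (fun j => c (x 0 j) + t * y j) p =
    t ^+ i * mmap c (fun j => c (x 0 j) + y j) p.
Proof.
case=> a ->; rewrite !raddf_sum mulr_sumr; apply: eq_bigr => k /eqP kE /=.
rewrite !mmapZ mulrCA; congr (_ * _); rewrite !rmorph_prod /=.
have -> : t ^+ i = \prod_(j < N) t ^+ (k : 'X_{1..N}) j.
  by rewrite prodrXr -mdegE kE.
rewrite -big_split; apply: eq_bigr => j _ /=.
rewrite !rmorphXn !rmorphB /= !mmapX !mmap1U !mmapC.
by rewrite ![c _ + _]addrC !addrK exprMn.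
Qed.

(** Translate [x] to the origin by [tp], split by total degree there, and translate back by [tm]. *)
Lemma expansion_exists x f : exists d g, expansion_at x f d g.
Proof.
pose tp := [tuple 'X_j + (x 0 j)%:MP | j < N] : N.-tuple {mpoly F[N]}.
pose tm := [tuple 'X_j - (x 0 j)%:MP | j < N] : N.-tuple {mpoly F[N]}.
pose f' := f \mPo tp.
have fE : f = f' \mPo tm.
  rewrite /f' [f \mPo _]/comp_mpoly [RHS]rmorph_mmap /=.
  rewrite -[LHS]comp_mpoly_id.
  apply: eq_bigr => k _ /=; rewrite comp_mpolyC; congr (_ * _).
  apply: mmap1_eq => j /=.
  by rewrite !tnth_mktuple rmorphD /= comp_mpolyC comp_mpolyXU -tnth_nth
    tnth_mktuple addrNK.
exists (msize f'), (fun i => pihomog mdeg i f' \mPo tm).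
split=> [i _|]; last first.
  rewrite big_mkord {1}fE.
  rewrite {1}(pihomog_partitionE (mf := mdeg) (leqnSn (msize f'))).
  by rewrite rmorph_sum.
exists (fun k => (pihomog mdeg i f')@_k).
have hom := pihomogP mdeg i f'.
rewrite -{1}(pihomog_id mdeg i f') (pihomogwE _ _ (k := i.+1)); last first.
  rewrite mmeasureE; apply/bigmax_leqP_seq => k kp _.
  by rewrite (dhomogP _ _ _ hom).
rewrite raddf_sum; apply: eq_bigr => k _ /=.
rewrite comp_mpolyZ comp_mpolyX; congr (_ *: _).
by apply: eq_bigr => j _; rewrite tnth_mktuple.
Qed.

Lemma mmap_polyC_mpoly p :
  mmap (polyC \o @mpolyC N F) (fun j => ('X_j)%:P) p = p%:P.
Proof.
rewrite {2}[p]mpolyE rmorph_sum; apply: eq_bigr => k _ /=.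
rewrite -mul_mpolyC rmorphM mpolyXE_id rmorph_prod; congr (_ * _).
by apply: eq_bigr => j _; rewrite rmorphXn.
Qed.

(* The substitution of [x + t (X - x)] for the variables, with [t] a new
   indeterminate, reads off the homogeneous components of [f] at [x]. *)
Definition radial_expansion x f : {poly {mpoly F[N]}} :=
  mmap (polyC \o @mpolyC N F)
    (fun j => ((x 0 j)%:MP)%:P + 'X * ('X_j - (x 0 j)%:MP)%:P) f.

Lemma radial_expansionE x f d g :
  expansion_at x f d g ->
  radial_expansion x f = \sum_(0 <= i < d.+1) 'X^i * (g i)%:P.
Proof.
case=> hom ->; rewrite /radial_expansion raddf_sum.
apply: eq_big_nat => i /andP[_ lei] /=.
rewrite (homogeneous_mmap _ _ _ (hom i lei)); congr (_ * _).
rewrite -mmap_polyC_mpoly; apply: eq_mmap => // j /=.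
by rewrite -rmorphD /= addrC addrNK.
Qed.

(** The coefficient of ['X^i] in the radial expansion is the component of degree [i], so the power
    of ['X] that splits off marks the lowest one. *)
Lemma initial_polynomial_radial x f k (q : {poly {mpoly F[N]}}) :
  radial_expansion x f = 'X^k * q -> q`_0 != 0 -> initial_polynomial x f q`_0.
Proof.
move=> fE q0; have [d [g fg]] := expansion_exists x f.
have coefg i : (i <= d)%N -> g i = ('X^k * q)`_i.
  move=> led; rewrite -fE (radial_expansionE fg) coef_sum big_mkord.
  rewrite (bigD1 (inord i)) //= big1 => [|j neq].
    by rewrite inordK // coefXnM ltnn subnn coefC addr0.
  rewrite coefXnM coefC; case: ltngtP => // [ltji|eqij].
    by rewrite subn_eq0 leqNgt ltji.
  by move: neq; rewrite -val_eqE /= inordK // eqij eqxx.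
(* Otherwise all components have degree below [k], and the coefficient of ['X^k], which is the
   constant term of [q], would be zero. *)
have led : (k <= d)%N.
  rewrite leqNgt; apply: contra_neqN q0 => ltdk.
  have /(congr1 (fun p : {poly _} => p`_k)) := fE.
  rewrite coefXnM ltnn subnn => <-.
  rewrite (radial_expansionE fg) coef_sum big_nat big1 // => i /andP[_ ltid].
  have ltik : (i < k)%N by apply: leq_trans ltdk.
  by rewrite coefXnM coefC ltnNge (ltnW ltik) subn_eq0 leqNgt ltik.
exists d, g, k; split => //.
- by rewrite coefg // coefXnM ltnn subnn.
- by move=> j ltjk; rewrite coefg ?coefXnM ?ltjk // ltnW // (leq_trans ltjk).
- by rewrite coefg // coefXnM ltnn subnn.
Qed.

(** Along the curve x + t y(t) the component of degree j is divisible by t^j. With i the initial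
    degree, the coefficient of t^i in [f] is therefore the value of [p] at x + y(0). *)
Lemma initial_polynomial_curve x f p (y : 'I_N -> {poly F}) :
  initial_polynomial x f p ->
  mmap polyC (fun j => (x 0 j)%:P + 'X * y j) f = 0 ->
  meval (fun j => x 0 j + (y j)`_0) p = 0.
Proof.
case=> d [g [i [[hom ->] led nz g0 ->]]]; rewrite raddf_sum /=.
move=> /(congr1 (fun q : {poly F} => q`_i)); rewrite coef0 coef_sum big_mkord.
rewrite (bigD1 (inord i)) //= big1 => [|j neq]; last first.
  have [ltji|leij] := ltnP j i; first by rewrite g0 // raddf0 coef0.
  rewrite (homogeneous_mmap _ _ _ (hom _ (ltn_ord j))) coefXnM.
  suff -> : (i < j)%N by [].
  rewrite ltn_neqAle leij andbT; apply: contraNneq neq => ->.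
  by rewrite inord_val.
rewrite inordK // addr0 (homogeneous_mmap _ _ _ (hom _ led)) coefXnM ltnn subnn.
(* The constant term is evaluation at 0, a ring morphism, so it passes inside the substitution. *)
rewrite -horner_coef0 -[_.[0]]/(horner_eval 0 _) rmorph_mmap => ev.
apply: etrans ev; apply: eq_mmap => [a|j] /=; rewrite /horner_eval.
  by rewrite hornerC.
by rewrite hornerD hornerC horner_coef0.
Qed.

End PolynomialExpansions.

(** * Bordered minors and their factorization *)

Section BorderedMinors.

(** The factors of a rank factorization of [M] have one-sided inverses; [pid_mx k] cuts the
    resulting identity down to order [k]. *)
Lemma mulmx_rank_identity (F : fieldType) (m n k : nat) (M : 'M[F]_(m, n)) :
  (k <= \rank M)%N -> exists C D, C *m M *m D = 1%:M :> 'M_k.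
Proof.
move=> lek.
have [L LM] : exists L, L *m col_base M = 1%:M.
  by exists (pinvmx (col_base M)); rewrite mulVpmx ?col_base_full.
have [R MR] : exists R, row_base M *m R = 1%:M.
  by exists (pinvmx (row_base M)); rewrite mulmxVp ?row_base_free.
exists (pid_mx k *m L), (R *m pid_mx k).
have -> : (pid_mx k : 'M_(k, _)) *m L *m M =
          pid_mx k *m (L *m col_base M) *m row_base M.
  by rewrite -2!mulmxA -(mulmxA L) mulmx_base.
rewrite LM mulmx1 mulmxA -[_ *m row_base M *m R]mulmxA MR mulmx1.
by rewrite pid_mx_id // pid_mx_1.
Qed.

Lemma det_block_scale_rows (S : comNzRingType) (s k : nat) (t : S)
    (a : 'M_s) (b : 'M_(s, k)) (c : 'M_(k, s)) (d : 'M_k) :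
  \det (block_mx a b (t *: c) (t *: d)) = t ^+ k * \det (block_mx a b c d).
Proof.
have -> : block_mx a b (t *: c) (t *: d) =
          block_mx 1%:M 0 0 t%:M *m block_mx a b c d.
  by rewrite mulmx_block !mul1mx !mul0mx !addr0 !add0r !mul_scalar_mx.
by rewrite det_mulmx det_lblock det1 mul1r det_scalar.
Qed.

Variables (S : comNzRingType) (m n s k : nat).
Variables (A : 'M[S]_(s, m)) (B : 'M[S]_(n, s)).
Variables (C : 'M[S]_(k, m)) (D : 'M[S]_(n, k)).

Definition bordered_minor (Y : 'M[S]_(m, n)) : S :=
  \det (col_mx A C *m Y *m row_mx B D).

(** The bordered minor at [X + t *: Z] with a factor [t] removed from each of its last [k] rows.
    Keeping [Y] and [Z] separate lets it be evaluated at [t = 0] and in the limit. *)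
Definition bordered_quotient (Y Z : 'M[S]_(m, n)) : S :=
  \det (block_mx (A *m Y *m B) (A *m Y *m D) (C *m Z *m B) (C *m Z *m D)).

Lemma bordered_minor_factor (X Z : 'M[S]_(m, n)) (t : S) :
  C *m X = 0 ->
  bordered_minor (X + t *: Z) = t ^+ k * bordered_quotient (X + t *: Z) Z.
Proof.
move=> CX; rewrite /bordered_minor mul_col_mx mul_col_row (mulmxDr C) CX add0r.
by rewrite -scalemxAr -!scalemxAl det_block_scale_rows.
Qed.

Lemma bordered_quotient1 (X Z : 'M[S]_(m, n)) :
  A *m X *m B = 1%:M -> X *m D = 0 -> C *m Z *m D = 1%:M ->
  bordered_quotient X Z = 1.
Proof.
move=> AXB XD CZD; rewrite /bordered_quotient AXB -[A *m X *m D]mulmxA XD.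
by rewrite mulmx0 CZD det_lblock !det1 mulr1.
Qed.

End BorderedMinors.

Lemma map_bordered_minor (S T : comNzRingType) (phi : {rmorphism S -> T})
    (m n s k : nat) (A : 'M[S]_(s, m)) B (C : 'M_(k, m)) D (Y : 'M_(m, n)) :
  phi (bordered_minor A B C D Y) =
  bordered_minor (map_mx phi A) (map_mx phi B) (map_mx phi C) (map_mx phi D)
    (map_mx phi Y).
Proof. by rewrite -det_map_mx !map_mxM map_col_mx map_row_mx. Qed.

Lemma map_bordered_quotient (S T : comNzRingType) (phi : {rmorphism S -> T})
    (m n s k : nat) (A : 'M[S]_(s, m)) B (C : 'M_(k, m)) D (Y Z : 'M_(m, n)) :
  phi (bordered_quotient A B C D Y Z) =
  bordered_quotient (map_mx phi A) (map_mx phi B) (map_mx phi C)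
    (map_mx phi D) (map_mx phi Y) (map_mx phi Z).
Proof. by rewrite -det_map_mx map_block_mx !map_mxM. Qed.

(** The product has rank at most that of [X + t *: B]; expanding it exhibits a cubic curve through
    [X] with velocity [U *m X + B + X *m V]. *)
Lemma mulmx_perturbations (S : comNzRingType) (m n : nat) (U : 'M[S]_m)
    (V : 'M[S]_n) (X B : 'M[S]_(m, n)) (t : S) :
  (1%:M + t *: U) *m (X + t *: B) *m (1%:M + t *: V) =
  X + t *: (U *m X + B + X *m V
            + t *: (U *m B + U *m X *m V + B *m V + t *: (U *m B *m V))).
Proof.
rewrite !(mulmxDl, mulmxDr) !mul1mx !mulmx1 -!scalemxAl -!scalemxAr.
rewrite -!scalemxAl !scalerDr !scalerA !addrA.
by rewrite [LHS](ACl (1*3*2*5*4*7*6*8)).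
Qed.

(** * Bordering vectors and curves of bounded rank *)

Section RankGeometry.
Variables (F : fieldType) (m n r : nat) (X : 'M[F]_(m, n)).

Lemma bordered_minor_eq0 (s k : nat) (A : 'M_(s, m)) B (C : 'M_(k, m)) D
    (Y : 'M[F]_(m, n)) :
  (\rank Y < s + k)%N -> bordered_minor A B C D Y = 0.
Proof.
move=> ltY; apply/eqP; apply: contraLR ltY => nz; rewrite -leqNgt.
have : \rank (col_mx A C *m Y *m row_mx B D) = (s + k)%N.
  by apply/eqP; rewrite -[_ == _]/(row_free _) row_free_unit unitmxE unitfE.
by move=> <-; rewrite (leq_trans (mxrankM_maxl _ _)) ?mxrankM_maxr.
Qed.

Lemma bordering_exists (p q k : nat) (P : 'M_(m, p)) (Q : 'M_(n, q))
    (Z : 'M[F]_(m, n)) :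
  P^T *m X = 0 -> X *m Q = 0 -> (k <= \rank (P^T *m Z *m Q))%N ->
  exists (A : 'M_(\rank X, m)) (B : 'M_(n, \rank X)) (C : 'M_(k, m))
    (D : 'M_(n, k)),
    [/\ A *m X *m B = 1%:M, C *m X = 0, X *m D = 0 & C *m Z *m D = 1%:M].
Proof.
move=> PX XQ /mulmx_rank_identity[C [D CD]].
have [A [B AB]] := mulmx_rank_identity (leqnn (\rank X)).
(* Passing through [P^T] and [Q] places the bordering vectors in the left and right kernels of
   [X]. *)
exists A, B, (C *m P^T), (Q *m D); split=> //.
- by rewrite -mulmxA PX mulmx0.
- by rewrite mulmxA XQ mul0mx.
- by rewrite -CD !mulmxA.
Qed.

(* With [G] a generalized inverse of [X], the projections [E = X G] and
   [E' = G X] split [Z] into four blocks: the two diagonal ones perturb [X]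
   additively, the two others are absorbed in invertible factors. *)
Lemma rank_le_curve (p q : nat) (P : 'M_(m, p)) (Q : 'M_(n, q))
    (Z : 'M[F]_(m, n)) :
  mxim P = mxker X^T -> mxim Q = mxker X -> (\rank X <= r)%N ->
  (\rank (P^T *m Z *m Q) <= r - \rank X)%N ->
  exists W0 W1 : 'M[F]_(m, n),
    forall t, (\rank (X + t *: (Z + t *: (W0 + t *: W1)))%R <= r)%N.
Proof.
move=> imP imQ leX leZ.
pose G := pinvmx X; have XGX : X *m G *m X = X by rewrite mulmxKpV.
pose E := X *m G; pose E' := G *m X.
have kerP k (U : 'M_(k, m)) : U *m X = 0 -> (U <= P^T)%MS.
  move=> UX; apply/row_subP => i.
  have : mxker X^T (row i U)^T.
    by rewrite /mxker /= -trmx_mul -row_mul UX row0 trmx0.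
  rewrite -imP => -[v _ /(congr1 trmx)]; rewrite trmxK trmx_mul => <-.
  exact: submxMl.
have kerQ k (U : 'M_(n, k)) : X *m U = 0 -> (U^T <= Q^T)%MS.
  move=> XU; apply/row_subP => i.
  have : mxker X (col i U) by rewrite /mxker /= colE mulmxA XU mul0mx.
  rewrite -imQ -tr_col => -[v _ <-]; rewrite trmx_mul.
  exact: submxMl.
have [C CP] : exists C, 1%:M - E = C *m P^T.
  apply/submxP/kerP; rewrite mulmxBl mul1mx.
  by rewrite /E XGX subrr.
have [D QD] : exists D, 1%:M - E' = Q *m D.
  have /submxP[D /(congr1 trmx)] : ((1%:M - E')^T <= Q^T)%MS.
    by apply: kerQ; rewrite mulmxBr mulmx1 /E' mulmxA XGX subrr.
  by rewrite trmx_mul !trmxK => ?; exists D^T.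
pose al := (1%:M - E) *m Z *m G; pose ga := G *m Z *m (1%:M - E').
pose be := E *m Z *m E' + (1%:M - E) *m Z *m (1%:M - E').
have ZE : al *m X + be + X *m ga = Z.
  have -> : al *m X = (1%:M - E) *m Z *m E' by rewrite /al /E' !mulmxA.
  have -> : X *m ga = E *m Z *m (1%:M - E') by rewrite /ga /E !mulmxA.
  rewrite /be addrA -[LHS]addrA -!mulmxDl subrK mul1mx.
  by rewrite -mulmxDr addrC subrK mulmx1.
(* These are the coefficients of t^2 and t^3 in (1 + t al)(X + t be)(1 + t ga). *)
exists (al *m be + al *m X *m ga + be *m ga), (al *m be *m ga) => t.
rewrite -{1}ZE -mulmx_perturbations.
rewrite (leq_trans (mxrankM_maxl _ _)) // (leq_trans (mxrankM_maxr _ _)) //.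
(* The first summand has rank at most [\rank X]; the second factors through [P^T *m Z *m Q] and has
   rank at most [r - \rank X]. *)
have -> : X + t *: be = X *m (G *m (X + t *: (Z *m E')))
   + t *: (C *m (P^T *m Z *m Q) *m D).
  rewrite /be CP QD scalerDr addrA !mulmxDr mulmxA XGX /E -!scalemxAr.
  by rewrite !mulmxA.
rewrite (leq_trans (mxrank_add _ _)) // -(subnKC leX) leq_add ?mxrankM_maxl //.
rewrite (leq_trans (mxrank_scale _ _)) // (leq_trans _ leZ) //.
by rewrite (leq_trans (mxrankM_maxl _ _)) ?mxrankM_maxr.
Qed.

End RankGeometry.

Lemma mxim_mxker_mul0 (F : fieldType) (m p q : nat) (P : 'M[F]_(m, p))
    (Y : 'M[F]_(q, m)) :
  mxim P = mxker Y -> Y *m P = 0.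
Proof.
move=> imP; apply/trmx_inj/row_matrixP => j.
rewrite trmx0 row0 -tr_col colE -mulmxA -[RHS]trmx0; congr trmx.
by have : mxker Y (P *m delta_mx j 0) by rewrite -imP; exists (delta_mx j 0).
Qed.

(** * The algebraic tangent cone of the rank variety *)

Section ConesOfRankVarieties.
Import mpoly.
Variables (F : fieldType) (m n r : nat) (X : 'M[F]_(m, n)).

Definition generic_mx : 'M[{mpoly F[m * n]}]_(m, n) :=
  \matrix_(i, j) 'X_(mxvec_index i j).

Lemma map_generic_mx (S : comNzRingType) (c : {rmorphism F -> S})
    (h : 'I_(m * n) -> S) :
  map_mx (mmap c h) generic_mx = \matrix_(i, j) h (mxvec_index i j).
Proof. by apply/matrixP => i j; rewrite !mxE mmapX mmap1U. Qed.

Lemma map_mx_mpolyC (S : comNzRingType) (c : {rmorphism F -> S})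
    (h : 'I_(m * n) -> S) (p q : nat) (A : 'M_(p, q)) :
  map_mx (mmap c h) (map_mx (@mpolyC (m * n) F) A) = map_mx c A.
Proof. by apply/matrixP => i j; rewrite !mxE mmapC. Qed.

Lemma map_generic_mx_meval (Y : 'M[F]_(m, n)) :
  map_mx (meval (mxvec Y 0)) generic_mx = Y.
Proof. by rewrite map_generic_mx; apply/matrixP => i j; rewrite mxE mxvecE. Qed.

Lemma mx_algebraic_tangent_cone_rank (p q : nat) (P : 'M_(m, p))
    (Q : 'M_(n, q)) (Z : 'M[F]_(m, n)) :
  P^T *m X = 0 -> X *m Q = 0 -> (\rank X <= r)%N ->
  mx_algebraic_tangent_cone (rank_le F m n r) X Z ->
  (\rank (P^T *m Z *m Q) <= r - \rank X)%N.
Proof.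
move=> PX XQ leX coneZ; rewrite leqNgt; apply/negP => ltZ.
(* The strict inequality supplies [k = (r - \rank X).+1], so the bordered minor has order r + 1. *)
have [A [B [C [D [AXB CX XD CZD]]]]] := bordering_exists PX XQ ltZ.
pose c := @mpolyC (m * n) F.
pose f := bordered_minor (map_mx c A) (map_mx c B) (map_mx c C) (map_mx c D)
            generic_mx.
pose X' := map_mx (polyC \o c) X.
pose q0 := bordered_quotient (map_mx (polyC \o c) A) (map_mx (polyC \o c) B)
  (map_mx (polyC \o c) C) (map_mx (polyC \o c) D)
  (X' + 'X *: (map_mx polyC generic_mx - X')) (map_mx polyC generic_mx - X').
have radf : radial_expansion (mxvec X) f = 'X^((r - \rank X).+1) * q0.
  rewrite /radial_expansion map_bordered_minor !map_mx_mpolyC.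
  rewrite -bordered_minor_factor; last by rewrite -map_mxM CX map_mx0.
  rewrite map_generic_mx; congr bordered_minor; apply/matrixP => i j.
  by rewrite !mxE !mxvecE rmorphB.
(* At t = 0 and at the point [Z] this is the bordered quotient of [X] and [Z - X]; since
   [C *m X = 0], the lower right block is still the identity. *)
have evq0 : meval (mxvec Z 0) q0`_0 = 1.
  rewrite -horner_coef0 -[_.[0]]/(horner_eval 0 _).
  rewrite -[meval _ _]/((meval (mxvec Z 0) \o horner_eval 0) q0).
  rewrite map_bordered_quotient.
  have ev k l (U : 'M_(k, l)) :
      map_mx (meval (mxvec Z 0) \o horner_eval 0) (map_mx (polyC \o c) U) = U.
    apply/matrixP => i j.
    by rewrite !mxE /= /horner_eval hornerC mevalC.
  rewrite !ev map_mxD map_mxZ !map_mxB !ev /=.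
  rewrite {1 2}/horner_eval hornerX raddf0 scale0r addr0.
  have -> : map_mx (meval (mxvec Z 0) \o horner_eval 0)
              (map_mx polyC generic_mx) = Z.
    rewrite -[RHS]map_generic_mx_meval; apply/matrixP => i j.
    by rewrite !mxE /= /horner_eval hornerC.
  by apply: bordered_quotient1; rewrite // mulmxBr CX subr0.
have nzq0 : q0`_0 != 0.
  by apply: contra_eq_neq evq0 => ->; rewrite raddf0 eq_sym oner_eq0.
suff /eqP : meval (mxvec Z 0) q0`_0 = 0 by rewrite evq0 oner_eq0.
apply: (coneZ f).
- apply: contraNneq nzq0 => f0; move: radf; rewrite f0.
  rewrite [LHS]raddf0 => /(congr1 (fun u : {poly _} => u`_(r - \rank X).+1)).
  by rewrite coef0 coefXnM ltnn subnn => <-.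
- move=> _ [Y leY <-]; rewrite map_bordered_minor map_generic_mx_meval.
  apply: bordered_minor_eq0; apply: leq_ltn_trans leY _.
  by rewrite addnS subnKC.
- exact: initial_polynomial_radial radf nzq0.
Qed.

Lemma rank_mx_algebraic_tangent_cone (p q : nat) (P : 'M_(m, p))
    (Q : 'M_(n, q)) (Z : 'M[F]_(m, n)) :
  (forall u : {poly F}, (forall t, u.[t] = 0) -> u = 0) ->
  mxim P = mxker X^T -> mxim Q = mxker X -> (\rank X <= r)%N ->
  (\rank (P^T *m Z *m Q) <= r - \rank X)%N ->
  mx_algebraic_tangent_cone (rank_le F m n r) X Z.
Proof.
move=> Finf imP imQ leX leZ f p0 _ f0 inp.
(* The initial polynomial is evaluated at [Z] itself, with no translation by [X], so the curve must
   leave [X] with velocity [Z - X]. *)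
have leZX : (\rank (P^T *m (Z - X) *m Q) <= r - \rank X)%N.
  by rewrite mulmxBr mulmxBl -(mulmxA P^T X) (mxim_mxker_mul0 imQ) mulmx0 subr0.
have [W0 [W1 curve]] := rank_le_curve imP imQ leX leZX.
pose y j := (mxvec (Z - X) 0 j)%:P
  + 'X * ((mxvec W0 0 j)%:P + 'X * (mxvec W1 0 j)%:P).
rewrite -(initial_polynomial_curve (y := y) inp).
  apply: meval_eq => j; rewrite /y coefD coefC coefXM addr0.
  by case/mxvec_indexP: j => i j; rewrite !mxvecE !mxE /= addrCA subrr addr0.
(* [f] along the curve is a polynomial in t; it is zero because each of its values is taken at a
   matrix of rank at most [r]. *)
apply: Finf => t; rewrite -[_.[t]]/(horner_eval t _) rmorph_mmap.
rewrite -(f0 (mxvec (X + t *: (Z - X + t *: (W0 + t *: W1))))); last first.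
  by eexists; first exact: (curve t).
apply: eq_mmap => [a|j] /=; rewrite /horner_eval ?hornerC //.
by case/mxvec_indexP: j => i j; rewrite /y !hornerE !mxvecE !mxE.
Qed.

End ConesOfRankVarieties.

(* Imported only here because their notations clash with those of mpoly. *)
From mathcomp Require Import boolp classical_sets reals topology normedtype.
From mathcomp Require Import sequences.
Import Order.TTheory Num.Theory numFieldNormedType.Exports.
Local Open Scope classical_set_scope.

(** * Entrywise limits of matrices and determinants *)

Section EntrywiseLimits.
Variable R : realType.

Definition entrywise_cvg (m n : nat) (u : nat -> 'M[R]_(m, n))
    (L : 'M[R]_(m, n)) :=
  forall i j, u k i j @[k --> \oo] --> L i j.

Lemma cvg_entrywise (m n : nat) (u : nat -> 'M[R]_(m, n)) (L : 'M[R]_(m, n)) :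
  u k @[k --> \oo] --> L -> entrywise_cvg u L.
Proof.
move=> uL i j.
exact: (cvg_comp u (fun M => M i j) uL (@coord_continuous _ _ _ i j L)).
Qed.

Lemma entrywise_cvg_cst (m n : nat) (L : 'M[R]_(m, n)) :
  entrywise_cvg (fun=> L) L.
Proof. by move=> i j; exact: cvg_cst. Qed.

Lemma entrywise_cvgM (m n p : nat) (u : nat -> 'M[R]_(m, n))
    (v : nat -> 'M_(n, p)) L K :
  entrywise_cvg u L -> entrywise_cvg v K ->
  entrywise_cvg (fun k => u k *m v k) (L *m K).
Proof.
move=> uL vK i j; rewrite mxE; under eq_fun do rewrite mxE.
apply: cvg_big => [|l _]; first exact: add_continuous.
exact: cvgM.
Qed.

Lemma entrywise_cvg_block (m1 m2 n1 n2 : nat)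
    (a : nat -> 'M[R]_(m1, n1)) (b : nat -> 'M_(m1, n2))
    (c : nat -> 'M_(m2, n1)) (d : nat -> 'M_(m2, n2)) La Lb Lc Ld :
  entrywise_cvg a La -> entrywise_cvg b Lb -> entrywise_cvg c Lc ->
  entrywise_cvg d Ld ->
  entrywise_cvg (fun k => block_mx (a k) (b k) (c k) (d k))
    (block_mx La Lb Lc Ld).
Proof.
move=> aL bL cL dL i j.
case: (split_ordP i) => i' ->; case: (split_ordP j) => j' ->.
- by rewrite block_mxEul; under eq_fun do rewrite block_mxEul; exact: aL.
- by rewrite block_mxEur; under eq_fun do rewrite block_mxEur; exact: bL.
- by rewrite block_mxEdl; under eq_fun do rewrite block_mxEdl; exact: cL.
- by rewrite block_mxEdr; under eq_fun do rewrite block_mxEdr; exact: dL.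
Qed.

Lemma cvg_det (n : nat) (u : nat -> 'M[R]_n) L :
  entrywise_cvg u L -> \det (u k) @[k --> \oo] --> \det L.
Proof.
move=> uL; apply: cvg_big => [|s _]; first exact: add_continuous.
apply: cvgM; first exact: cvg_cst.
by apply: cvg_big => [|i _]; [exact: mul_continuous | exact: uL].
Qed.

End EntrywiseLimits.

(** * The tangent cone over the reals *)

Section TangentConeOfRankVariety.
Variables (R : realType) (m n r p q : nat) (X : 'M[R]_(m, n)).
Variables (P : 'M[R]_(m, p)) (Q : 'M[R]_(n, q)).
Hypotheses (leX : (\rank X <= r)%N).
Hypotheses (imP : mxim P = mxker X^T) (imQ : mxim Q = mxker X).

Lemma rank_tangent_cone (Z : 'M[R]_(m, n)) :
  (\rank (P^T *m Z *m Q) <= r - \rank X)%N ->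
  tangent_cone (rank_le R m n r) X Z.
Proof.
move=> leZ; have [W0 [W1 curve]] := rank_le_curve imP imQ leX leZ.
(* The curve is sampled at the positive times 1/(i+1), which tend to 0. *)
pose t (i : nat) : R := i.+1%:R^-1.
have t0 : t i @[i --> \oo] --> 0 by exact: cvg_harmonic.
have sub_cvg (U V : 'M[R]_(m, n)) (v : nat -> 'M[R]_(m, n)) :
    v i @[i --> \oo] --> V -> U + t i *: v i @[i --> \oo] --> U.
  move=> vV; rewrite -[X in _ --> X]addr0 -(scale0r V).
  by apply: cvgD; [exact: cvg_cst | exact: cvgZ].
have W : Z + t i *: (W0 + t i *: W1) @[i --> \oo] --> Z.
  by apply: (sub_cvg _ W0); apply: (sub_cvg _ W1); exact: cvg_cst.
exists (fun i => X + t i *: (Z + t i *: (W0 + t i *: W1))), t; split.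
- by move=> i; exact: curve.
- exact: sub_cvg W.
- by move=> i; rewrite invr_gt0 ltr0n.
- under eq_fun do
    rewrite addrC addKr scalerA mulVf ?invr_eq0 ?pnatr_eq0 // scale1r.
  exact: W.
Qed.

Lemma tangent_cone_rank (Z : 'M[R]_(m, n)) :
  tangent_cone (rank_le R m n r) X Z ->
  (\rank (P^T *m Z *m Q) <= r - \rank X)%N.
Proof.
move=> [x [t [lex xX t_gt0 zZ]]]; rewrite leqNgt; apply/negP => ltZ.
have PX : P^T *m X = 0.
  by apply: trmx_inj; rewrite trmx0 trmx_mul trmxK (mxim_mxker_mul0 imP).
have [A [B [C [D [AXB CX XD CZD]]]]] :=
  bordering_exists PX (mxim_mxker_mul0 imQ) ltZ.
pose z i := (t i)^-1 *: (x i - X).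
(* The minor vanishes at [x i], and the nonzero power of [t i] can be cancelled; by continuity the
   quotient at the limit would be 0, whereas it equals 1. *)
have quo0 i : bordered_quotient A B C D (x i) (z i) = 0.
  have : bordered_minor A B C D (x i) = 0.
    apply: bordered_minor_eq0; apply: leq_ltn_trans (lex i) _.
    by rewrite addnS subnKC.
  have tn0 : t i != 0 by rewrite gt_eqF.
  have xE : x i = X + t i *: z i.
    by rewrite scalerA mulfV // scale1r addrC subrK.
  rewrite {1}xE bordered_minor_factor // -xE => /eqP.
  by rewrite mulf_eq0 expf_eq0 (negbTE tn0) andbF => /eqP.
have : bordered_quotient A B C D (x i) (z i) @[i --> \oo] -->
       bordered_quotient A B C D X Z.
  have xX' := cvg_entrywise xX; have zZ' := cvg_entrywise zZ.
  apply: cvg_det; apply: entrywise_cvg_block;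
    apply: entrywise_cvgM; try exact: entrywise_cvg_cst;
    by apply: entrywise_cvgM => //; exact: entrywise_cvg_cst.
rewrite (bordered_quotient1 AXB XD CZD); under eq_fun do rewrite quo0.
move/cvg_lim => lim1; move/eqP: (oner_neq0 R); apply.
by rewrite -lim1 // lim_cst.
Qed.

End TangentConeOfRankVariety.

(** * Polynomials vanishing everywhere, and the conclusion *)

Lemma closed_field_poly_eq0 (F : closedFieldType) (u : {poly F}) :
  (forall t, u.[t] = 0) -> u = 0.
Proof.
move=> u0; apply/eqP; apply: contraT => /closed_nonrootP[t].
by rewrite rootE u0 eqxx.
Qed.

Lemma num_field_poly_eq0 (F : numFieldType) (u : {poly F}) :
  (forall t, u.[t] = 0) -> u = 0.
Proof.
move=> u0; apply/eqP; apply: contraT => nzu.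
(* The naturals below [size u] are distinct in [F], one more of them than the degree of [u] allows
   as roots. *)
pose s : seq F := [seq i%:R | i <- iota 0 (size u)].
have /(max_poly_roots nzu) : all (root u) s.
  by apply/allP => t _; rewrite rootE u0.
rewrite map_inj_uniq ?iota_uniq; last first.
  by move=> i j /eqP; rewrite eqr_nat => /eqP.
by rewrite size_map size_iota ltnn => /(_ isT).
Qed.

Lemma mx_algebraic_tangent_coneE (F : fieldType) (m n r p q : nat)
    (X : 'M[F]_(m, n)) (P : 'M_(m, p)) (Q : 'M_(n, q)) :
  (forall u : {poly F}, (forall t, u.[t] = 0) -> u = 0) ->
  (\rank X <= r)%N -> mxim P = mxker X^T -> mxim Q = mxker X ->
  mx_algebraic_tangent_cone (rank_le F m n r) X =
    [set Z : 'M[F]_(m, n) | (\rank (P^T *m Z *m Q) <= r - \rank X)%N].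
Proof.
move=> Finf leX imP imQ; apply/seteqP; split=> Z.
  apply: mx_algebraic_tangent_cone_rank => //; last exact: mxim_mxker_mul0.
  by apply: trmx_inj; rewrite trmx0 trmx_mul trmxK (mxim_mxker_mul0 imP).
exact: rank_mx_algebraic_tangent_cone.
Qed.

Theorem theorem7p1 (m n r : nat) (hr : (r < minn m n)%N) :
  (forall (F : closedFieldType) (X : 'M[F]_(m, n))
      (P : 'M[F]_(m, m - \rank X)) (Q : 'M[F]_(n, n - \rank X)),
    rank_le F m n r X ->
    \rank P = (m - \rank X)%N ->
    \rank Q = (n - \rank X)%N ->
    mxim P = mxker X^T ->
    mxim Q = mxker X ->
    mx_algebraic_tangent_cone (rank_le F m n r) X =
      [set Z : 'M[F]_(m, n) | (\rank (P^T *m Z *m Q) <= r - \rank X)%N])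
  /\
  (forall (R : realType) (X : 'M[R]_(m, n))
      (P : 'M[R]_(m, m - \rank X)) (Q : 'M[R]_(n, n - \rank X)),
    rank_le R m n r X ->
    \rank P = (m - \rank X)%N ->
    \rank Q = (n - \rank X)%N ->
    mxim P = mxker X^T ->
    mxim Q = mxker X ->
    mx_algebraic_tangent_cone (rank_le R m n r) X =
      [set Z : 'M[R]_(m, n) | (\rank (P^T *m Z *m Q) <= r - \rank X)%N]
    /\
    tangent_cone (rank_le R m n r) X =
      mx_algebraic_tangent_cone (rank_le R m n r) X).

Proof.
split=> [F|R] X P Q leX _ _ imP imQ.
  by apply: mx_algebraic_tangent_coneE => //; exact: closed_field_poly_eq0.
have algE := mx_algebraic_tangent_coneE (@num_field_poly_eq0 R) leX imP imQ.
split=> //; rewrite algE; apply/seteqP; split=> Z.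
  exact: tangent_cone_rank.
exact: rank_tangent_cone.
Qed.
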